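(* Let $\{X_n\}$ be an adversarial Markov chain with data $(\mathcal{X},\eta,P,\pi,D,K,x_0)$ as in the context. Suppose: (A4) $P$ is geometrically ergodic: there are $\rho<1$ and a $\pi$-a.e. finite measurable function $\xi:\mathcal{X}\to[1,\infty]$ such that $\|P^n(x,\cdot)-\pi\|\le\xi(x)\rho^n$ for all $n\in\mathbf{N}$ and $x\in\mathcal{X}$; and (A5) there is $M<\infty$ such that $P(x,dz)\le M\,\pi(dz)$ for all $x\in K_D$ and $z\in K_{2D}$. Then $\{X_n\}$ is bounded in probability, i.e. $\lim_{L\to\infty}\sup_{n\in\mathbf{N}}\mathbf{P}(\eta(X_n,\mathbf{0})>L\mid X_0=x_0)=0$.
   Context: Norm: $\|\mu-\nu\|=\sup_{A\in\mathcal{F}}|\mu(A)-\nu(A)|$ for probability measures $\mu,\nu$. Adversarial Markov chain: $\mathcal{X}$ is a nonempty state space with a metric $\eta$, its Borel $\sigma$-algebra $\mathcal{F}$, and a specified origin point $\mathbf{0}\in\mathcal{X}$. $P$ is the transition kernel of a time-homogeneous Markov chain on $\mathcal{X}$ which is Harris ergodic with stationary probability distribution $\pi$: $\lim_{n\to\infty}\|P^n(x,\cdot)-\pi\|=0$ for every $x\in\mathcal{X}$. There is a constant $D<\infty$ with $P(x,\{y\in\mathcal{X}:\eta(x,y)\le D\})=1$ for all $x\in\mathcal{X}$. $K\in\mathcal{F}$ is a fixed bounded nonempty subset; for $r>0$, $K_r$ is the set of all states within distance $r$ of $K$. The adversarial Markov chain is a stochastic process $\{X_n\}_{n\ge 0}$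 with $X_0=x_0$ for a specific $x_0\in K$ such that: (i) whenever $X_n\notin K$, $\mathbf{P}(X_{n+1}\in A\mid X_0,\dots,X_n)=P(X_n,A)$ for all $A\in\mathcal{F}$; (ii) when $X_n\in K$ it may move arbitrarily according to an adversary, possibly depending on $n$ and on the history $X_0,\dots,X_n$ in a nonanticipatory manner, subject only to measurability (the conditional probabilities are well defined) and to the restriction that it cannot move more than a distance $D$ at each iteration, or more specifically that from $K$ it can only move to points of $K_D$. The inequality in (A5) means $P(x,A)\le M\pi(A)$ for all measurable $A\subseteq K_{2D}$ and all $x\in K_D$. *)

(* Defs.v *)
From HB Require Import structures.
From mathcomp Require Import all_boot all_order all_algebra.
From mathcomp Require Import all_classical all_reals all_analysis.
From mathcomp Require Import measurable_realfun.

Set Implicit Arguments.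
Unset Strict Implicit.
Unset Printing Implicit Defensive.
Import Order.TTheory GRing.Theory Num.Theory.
Import numFieldNormedType.Exports.

Local Open Scope classical_set_scope.
Local Open Scope ring_scope.

(** Nonempty metric spaces with their Borel sigma-algebra, without
    separability or completeness.  Nonemptiness comes from the pointed structure
    underlying [measurableType]. *)
HB.mixin Record Measurable_isBorel d (R : numDomainType) T
    & Measurable d T & Metric R T := {
  measurable_borel : @measurable d T = <<s @open T >>
}.

#[short(type="borelMetricType")]
HB.structure Definition BorelMetric d (R : numDomainType) :=
  {T of Measurable d T & Metric R T & Measurable_isBorel d R T}.

Section metric.
Context {R : realType} {T : metricType R}.

Definition metric_bounded (K : set T) : Prop :=
  exists r : R, forall x y, K x -> K y -> mdist x y <= r.

Lemma edist_mdist (x y : T) : edist (x, y) = (mdist x y)%:E.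
Proof.
rewrite /edist /=; apply/eqP; rewrite eq_le; apply/andP; split.
  apply/lee_addgt0Pr => e e0; apply: ereal_inf_lbound.
  exists (mdist x y + e) => //=; split; first by rewrite ltr_wpDl// mdist_ge0.
  by rewrite ballEmdist /= ltrDl.
apply: le_ereal_inf_tmp => _ /= [r [_ xry] <-].
by move: xry; rewrite lee_fin ballEmdist /= => /ltW.
Qed.

(** [K_r].  The distance to [K] is an infimum, so that [K_r] is closed, hence
    Borel; the infimum need not be attained.  By [edist_mdist], [edist_inf]
    is the infimum of the metric. *)
Definition enlargement (K : set T) (r : R) : set T :=
  [set y | (edist_inf K y <= r%:E)%E].

End metric.

Section markov.
Context {d : measure_display} {T : measurableType d} {R : realType}.

Definition tv_dist (mu nu : set T -> \bar R) : \bar R :=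
  ereal_sup [set `|mu A - nu A|%E | A in @measurable d T].

(** [iter_kernel P n x A] is [P^n(x, A)]. *)
Fixpoint iter_kernel (P : R.-pker T ~> T) (n : nat) (x : T) (A : set T)
    : \bar R :=
  if n is m.+1 then (\int[P x]_y iter_kernel P m y A)%E else \d_x A.

Definition stationary (P : R.-pker T ~> T) (pi : probability T R) : Prop :=
  forall A, measurable A -> (\int[pi]_x P x A)%E = pi A.

Definition harris_ergodic (P : R.-pker T ~> T) (pi : probability T R) : Prop :=
  stationary P pi /\
  forall x, tv_dist (iter_kernel P n x) pi @[n --> \oo] --> 0%E.

Definition geometrically_ergodic (P : R.-pker T ~> T) (pi : probability T R)
    : Prop :=
  exists (rho : R) (xi : T -> \bar R),
    [/\ rho < 1,
        measurable_fun setT xi,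
        forall x, (1 <= xi x)%E,
        {ae pi, forall x, (xi x < +oo)%E} &
        forall n x,
          (tv_dist (iter_kernel P n x) pi <= xi x * (rho ^+ n)%:E)%E].

End markov.

Section conditional_probability.
Context {d : measure_display} {Omega : measurableType d} {R : realType}.
Variable Pr : probability Omega R.

Definition cond_prob (A B : set Omega) : R :=
  fine (Pr (A `&` B)) / fine (Pr B).

(** [q] is a version of the conditional probability of the event [B] given the
    sub-sigma-algebra [G]. *)
Definition is_cond_prob (G : set (set Omega)) (B : set Omega)
    (q : Omega -> \bar R) : Prop :=
  [/\ forall U, measurable U -> G (q @^-1` U),
      Pr.-integrable setT q &
      forall E, G E -> (\int[Pr]_(w in E) q w)%E = Pr (E `&` B)].

End conditional_probability.

Section adversarial.
Context {d d' : measure_display} {R : realType} {T : borelMetricType d R}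
  {Omega : measurableType d'}.
Variable Pr : probability Omega R.

(** [sigma(X_0, ..., X_n)] *)
Definition history (X : nat -> {RV Pr >-> T}) (n : nat) : set (set Omega) :=
  g_sigma_preimage (fun i : 'I_n.+1 => (X i : Omega -> T)).

(** Inside [K] the conditional law of [X_{n+1}] given the history is only
    required to be carried by [K_D]; this leaves the adversary free to use the
    time, the past and any additional randomness on [Omega]. *)
Definition adversarial_chain (P : R.-pker T ~> T) (D : R) (K : set T) (x0 : T)
    (X : nat -> {RV Pr >-> T}) : Prop :=
  [/\ {ae Pr, forall w, X 0%N w = x0},
      forall n A, measurable A ->
        exists2 q, is_cond_prob Pr (history X n) (X n.+1 @^-1` A) q &
          {ae Pr, forall w, ~ K (X n w) -> q w = P (X n w) A} &
      forall n, {ae Pr, forall w, K (X n w) -> enlargement K D (X n.+1 w)}].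

Definition bounded_in_probability (o x0 : T) (X : nat -> {RV Pr >-> T})
    : Prop :=
  ereal_sup [set (cond_prob Pr [set w | L < mdist (X n w) o]
                               [set w | X 0%N w = x0])%:E | n in [set: nat]]
    @[L --> +oo%R] --> 0%E.

End adversarial.

(* Main.v *)
Require Import Defs.
From HB Require Import structures.
From mathcomp Require Import all_boot all_order all_algebra.
From mathcomp Require Import all_classical all_reals all_analysis.
From mathcomp Require Import measurable_realfun.

(** To be in a set [A] far from [K] at time [n], the process must have left [K]
    without returning.  Split according to the last time [j < n] with [X_j] in
    [K] ([last_visit_decomposition]).  From [X_{j+1}] on, the process follows
    [P] killed on [K].  Since jumps have length at most [D], the hypothesis that
    [pi] dominates [P(x, .)] on [K_{2D}] gives [P(x, .) <= M pi] on the whole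
    space for [x] in [K_D] ([kernel_le_stationary]).  When [A] is disjoint from
    [K_D], the term [j = n - 1] vanishes, and for smaller [j] the term is at
    most [M * \int taboo_k d pi], where [taboo_k(x)] is the probability that
    the [P]-chain started at [x] avoids [K] for [k = n - j - 2] steps and is
    then in [A] ([last_exit_le]).  By stationarity this integral is at most
    [pi A], and it is also at most the probability [s_k] that the stationary
    chain avoids [K] for [k] steps.  If [\sum_k s_k] converges, then
    [\sum_k min(pi A, s_k)] is small as soon as [pi A] is small, uniformly
    in [n] ([sum_small_of_summable]).

    What remains is [\sum_k s_k < oo], that is, finiteness of the stationary
    mean hitting time of [K], when [pi K > 0].  The function [xi] of the
    geometric bound need not be [pi]-integrable, so the bound cannot simply be
    integrated.  Instead, take [C] inside [K] with [pi C > 0] on which [xi] is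
    bounded.  From [C], the expected number of visits to [C] before time [N] is
    at most [N pi(C) + B] with [B] independent of [N], by summing the geometric
    series ([geometric_occupation_le]).  From any [x], no visit is counted
    before the hitting time [tau] of [C], hence the expected number of visits is
    at most [(N - E_x(min(tau, N))) pi(C) + B] ([occupation_hitting_le]).
    Integrated against [pi], the expected number of visits is exactly
    [N pi(C)], so [pi(C) E_pi(min(tau, N)) <= B] ([integral_taboo_summable]).

    If [pi K = 0], the process a.s. never returns to [K] once it has left it,
    so the last exits are disjoint events whose probabilities sum to at most
    [1], and [Pr(X_n in A) <= M pi(A)] ([null_adversarial_le]). *)

Set Implicit Arguments.
Unset Strict Implicit.
Unset Printing Implicit Defensive.
Import Order.TTheory GRing.Theory Num.Theory.
Import numFieldNormedType.Exports.

Local Open Scope classical_set_scope.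
Local Open Scope ring_scope.

(** * Comparing measures and their mixtures *)

Section mixture.
Local Open Scope ereal_scope.
Context {d d' : measure_display} {T : measurableType d}
  {W : measurableType d'} {R : realType}.
Variables (mu : {measure set W -> \bar R}) (D : set W).
Hypothesis mD : measurable D.

Import HBNNSimple.

Lemma integral_mixture_nnsfun (k : W -> {measure set T -> \bar R})
    (h : {nnsfun T >-> R}) :
  (forall A, measurable A -> measurable_fun setT (k ^~ A)) ->
  \int[mu]_(w in D) \int[k w]_x (h x)%:E =
  \sum_(r \in range h) r%:E * \int[mu]_(w in D) k w (h @^-1` [set r]).
Proof.
move=> mk; under eq_integral do rewrite integralT_nnsfun sintegralE.
have mkD r : measurable_fun D (fun w => k w (h @^-1` [set r])).
  by apply: measurable_funTS; exact: mk.
rewrite ge0_integral_fsum//; last 2 first.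
- by move=> r; exact: measurable_funeM.
- by move=> r w _; exact: nnsfun_mulemu_ge0.
apply: eq_fsbigr => r rh; rewrite ge0_integralZl//.
by move: rh; rewrite inE => -[x _ <-]; rewrite lee_fin.
Qed.

(** Two mixtures that agree on sets agree on nonnegative functions: pass to the
    limit along simple functions. *)
Lemma ge0_eq_integral_mixture (k1 k2 : W -> {measure set T -> \bar R})
    (g : T -> \bar R) :
  (forall A, measurable A -> measurable_fun setT (k1 ^~ A)) ->
  (forall A, measurable A -> measurable_fun setT (k2 ^~ A)) ->
  (forall A, measurable A ->
    \int[mu]_(w in D) k1 w A = \int[mu]_(w in D) k2 w A) ->
  measurable_fun setT g -> (forall x, 0 <= g x) ->
  \int[mu]_(w in D) \int[k1 w]_x g x = \int[mu]_(w in D) \int[k2 w]_x g x.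
Proof.
move=> mk1 mk2 k12 mg g0; pose h := nnsfun_approx measurableT mg.
have mh n : measurable_fun setT (EFin \o h n) by exact/measurable_EFinP.
have h0 n x : 0 <= (EFin \o h n) x by rewrite lee_fin.
have ndh x : {homo (fun n => (EFin \o h n) x) : m n / (m <= n)%N >-> m <= n}.
  by move=> m n mn; exact/lefP/nd_nnsfun_approx.
have limh (m : {measure set T -> \bar R}) :
    \int[m]_x g x = limn (fun n => \int[m]_x (EFin \o h n) x).
  rewrite -monotone_convergence//; apply: eq_integral => x _.
  by apply/esym/cvg_lim => //; exact: cvg_nnsfun_approx.
have limk (k : W -> {measure set T -> \bar R}) :
    (forall A, measurable A -> measurable_fun setT (k ^~ A)) ->
    \int[mu]_(w in D) \int[k w]_x g x =
    limn (fun n => \int[mu]_(w in D) \int[k w]_x (EFin \o h n) x).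
  move=> mk; rewrite -monotone_convergence//.
  - by apply: eq_integral => w _; rewrite limh.
  - move=> n; apply: measurable_funTS.
    exact: (measurable_fun_integral_kernel mk (h0 n) (mh n)).
  - by move=> n w _; apply: integral_ge0 => x _; exact: h0.
  - by move=> w _ m n mn; apply: ge0_le_integral => // x _; exact: ndh.
rewrite !limk//; congr (limn _); apply/funext => n.
rewrite !integral_mixture_nnsfun//.
by apply: eq_fsbigr => r _; rewrite k12.
Qed.

(** This turns conditional probabilities into conditional expectations.  It
    serves twice: with [Y] the next state of the process, and with [Y] the
    identity and [mu] stationary. *)
Lemma ge0_integral_conditional (Y : W -> T) (k : W -> {measure set T -> \bar R})
    (g : T -> \bar R) :
  measurable_fun setT Y ->
  (forall A, measurable A -> measurable_fun setT (k ^~ A)) ->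
  (forall A, measurable A -> \int[mu]_(w in D) k w A = mu (D `&` Y @^-1` A)) ->
  measurable_fun setT g -> (forall x, 0 <= g x) ->
  \int[mu]_(w in D) \int[k w]_x g x = \int[mu]_(w in D) g (Y w).
Proof.
move=> mY mk kY mg g0.
have diracY A w : \d_(Y w) A = (\1_(Y @^-1` A) w)%:E :> \bar R.
  by rewrite diracE.
have mYA A : measurable A -> measurable (Y @^-1` A).
  by move=> mA; rewrite -[X in measurable X]setTI; exact: mY.
(* [g (Y w)] is the integral of [g] against the Dirac mass at [Y w]. *)
rewrite (@ge0_eq_integral_mixture k (fun w => \d_(Y w)))//.
- by apply: eq_integral => w _; rewrite integral_dirac// diracT mul1e.
- move=> A mA; under eq_fun do rewrite /= diracY.
  by apply/measurable_EFinP; apply: measurable_indic; exact: mYA.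
- move=> A mA; under [RHS]eq_integral do rewrite /= diracY.
  by rewrite integral_indic ?kY 1?setIC//; exact: mYA.
Qed.

End mixture.

Lemma le_measure_ae {d} {W : measurableType d} {R : realType}
    (mu : {measure set W -> \bar R}) (A B : set W) :
  measurable A -> measurable B -> {ae mu, forall w, A w -> B w} ->
  (mu A <= mu B)%E.
Proof.
move=> mA mB AB; rewrite -(setIT A) -(setIT B) -!integral_indic//.
apply: ae_ge0_le_integral => //.
- by apply/measurable_EFinP; exact: measurable_indic.
- by apply/measurable_EFinP; exact: measurable_indic.
- apply: filterS AB => w AB _; rewrite lee_fin !indicE.
  by case: (boolP (w \in A)) => // /set_mem/AB Bw; rewrite mem_set.
Qed.

(** * Killed and iterated kernels *)

Section taboo.
Local Open Scope ereal_scope.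
Context {d : measure_display} {T : measurableType d} {R : realType}.
Implicit Types (P : R.-pker T ~> T) (pi : probability T R) (K C : set T)
  (g : T -> \bar R).

(** [taboo P K g n x] is the expectation of [g Y_n] on the event that none of
    [Y_0, ..., Y_{n-1}] is in [K], for the [P]-chain [Y] started at [x]. *)
Fixpoint taboo P K g (n : nat) : T -> \bar R :=
  if n is m.+1 then (fun x => \int[P x]_y taboo P K g m y) \_ (~` K) else g.

Lemma measurable_integral_kernel P g :
  measurable_fun setT g -> (forall x, 0 <= g x) ->
  measurable_fun setT (fun x => \int[P x]_y g y).
Proof.
by move=> mg g0; apply: (measurable_fun_integral_kernel (measurable_kernel P)).
Qed.

Lemma taboo_ge0 P K g n x : (forall x, 0 <= g x) -> 0 <= taboo P K g n x.
Proof.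
move=> g0; elim: n x => [//|n IHn] x /=.
by rewrite patchE; case: ifP => // _; apply: integral_ge0.
Qed.

Lemma measurable_taboo P K g n : measurable K ->
  measurable_fun setT g -> (forall x, 0 <= g x) ->
  measurable_fun setT (taboo P K g n).
Proof.
move=> mK mg g0; elim: n => [//|n IHn] /=.
apply: (measurable_restrictT _ (measurableC mK)).1.
apply: measurable_funTS; apply: measurable_integral_kernel => // x.
exact: taboo_ge0.
Qed.

Lemma le_taboo P K1 K2 g1 g2 n x : measurable K1 -> measurable K2 ->
  measurable_fun setT g1 -> measurable_fun setT g2 ->
  K1 `<=` K2 -> (forall x, 0 <= g2 x <= g1 x) ->
  taboo P K2 g2 n x <= taboo P K1 g1 n x.
Proof.
move=> mK1 mK2 mg1 mg2 K12 g12.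
have g20 y : 0 <= g2 y by case/andP: (g12 y).
have g10 y : 0 <= g1 y by case/andP: (g12 y); exact: le_trans.
elim: n x => [|n IHn] x /=; first by case/andP: (g12 x).
rewrite !patchE; case: ifPn => [|_]; last first.
  by case: ifP => // _; apply: integral_ge0 => y _; exact: taboo_ge0.
rewrite inE /= => K2x; rewrite mem_set/=; last by move/K12.
apply: ge0_le_integral => //.
- by move=> y _; exact: taboo_ge0.
- exact: measurable_taboo.
- exact: measurable_taboo.
Qed.

Lemma stationary_integral P pi g : stationary P pi ->
  measurable_fun setT g -> (forall x, 0 <= g x) ->
  \int[pi]_x \int[P x]_y g y = \int[pi]_x g x.
Proof.
move=> Ppi mg g0; apply: (@ge0_integral_conditional _ _ _ _ _ pi setT) => //.
- exact: measurable_kernel.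
- by move=> A mA; rewrite Ppi// setTI.
Qed.

Lemma integral_taboo_le P pi K g n : stationary P pi -> measurable K ->
  measurable_fun setT g -> (forall x, 0 <= g x) ->
  \int[pi]_x taboo P K g n x <= \int[pi]_x g x.
Proof.
move=> Ppi mK mg g0; elim: n => [//|n]; apply: le_trans.
rewrite -[leRHS](stationary_integral Ppi)//; last 2 first.
- exact: measurable_taboo.
- by move=> x; exact: taboo_ge0.
apply: ge0_le_integral => //.
- by move=> x _; exact: taboo_ge0.
- exact: measurable_taboo.
- apply: measurable_integral_kernel; first exact: measurable_taboo.
  by move=> x; exact: taboo_ge0.
- move=> x _ /=; rewrite patchE; case: ifP => // _.
  by apply: integral_ge0 => y _; exact: taboo_ge0.
Qed.

Lemma iter_kernel_ge0 P n x A : 0 <= iter_kernel P n x A.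
Proof.
by elim: n x => [|n IHn] x //=; apply: integral_ge0.
Qed.

Lemma measurable_iter_kernel P n A : measurable A ->
  measurable_fun setT (fun x => iter_kernel P n x A).
Proof.
move=> mA; elim: n => [|n IHn] /=.
  under eq_fun do rewrite diracE.
  by apply/measurable_EFinP; exact: measurable_indic.
apply: measurable_integral_kernel => // x; exact: iter_kernel_ge0.
Qed.

Lemma stationary_iter_kernel P pi n A : stationary P pi -> measurable A ->
  \int[pi]_x iter_kernel P n x A = pi A.
Proof.
move=> Ppi mA; elim: n => [|n IHn] /=.
  under eq_integral do rewrite diracE.
  by rewrite integral_indic// setIT.
rewrite stationary_integral//; first exact: measurable_iter_kernel.
by move=> x; exact: iter_kernel_ge0.
Qed.

Lemma integral_kernel_cst P x (r : \bar R) : \int[P x]_y cst r y = r.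
Proof. by rewrite integral_cst// prob_kernel mule1. Qed.

End taboo.

(** * The stationary mean hitting time is finite *)

Section hitting.
Local Open Scope ereal_scope.
Context {d : measure_display} {T : measurableType d} {R : realType}.
Variables (P : R.-pker T ~> T) (pi : probability T R).

(** If the linear bound on the expected number of visits holds from [C], then
    from elsewhere it improves by [p] for each unit of time spent before hitting
    [C]: the sum of the [taboo] functions is the truncated mean hitting time.
    Induction on [N] by conditioning on the first step replaces the strong
    Markov property; outside [C] both sides gain [p] at each step. *)
Lemma occupation_hitting_le (C : set T) (p B : R) : measurable C ->
    (0 <= p)%R -> (0 <= B)%R ->
    (forall N x, C x ->
      \sum_(m < N) iter_kernel P m x C <= (N%:R * p + B)%:E) ->
  forall N x, \sum_(m < N) iter_kernel P m x C +
    p%:E * \sum_(k < N) taboo P C (cst 1) k.+1 x <= (N%:R * p + B)%:E.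
Proof.
move=> mC p0 B0 occ; have cst_ge0 (y : T) : 0 <= cst (1 : \bar R) y by [].
have t0 k x : 0 <= taboo P C (cst 1) k x by exact: taboo_ge0.
have mt k : measurable_fun setT (taboo P C (cst 1) k).
  exact: measurable_taboo.
have mi k := @measurable_iter_kernel _ _ _ P k _ mC.
have i0 := @iter_kernel_ge0 _ T R P.
pose G N x := \sum_(m < N) iter_kernel P m x C.
pose S N x := \sum_(k < N) taboo P C (cst 1) k.+1 x.
have G0 N x : 0 <= G N x by exact: sume_ge0.
have S0 N x : 0 <= S N x by exact: sume_ge0.
have mG N : measurable_fun setT (G N) by exact: emeasurable_sum.
have mS N : measurable_fun setT (S N) by exact: emeasurable_sum.
suff: forall N x, G N x + p%:E * S N x <= (N%:R * p + B)%:E by [].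
elim=> [|N IHN] x.
  by rewrite /G /S !big_ord0 mule0 adde0 mul0r add0r lee_fin.
have [Cx|Cx] := pselect (C x).
  rewrite [S _ _]big1 ?mule0 ?adde0; first exact: occ.
  move=> k _ /=; rewrite patchE ifF//.
  by apply/negbTE; rewrite notin_setE => /(_ Cx).
have -> : G N.+1 x = \int[P x]_y G N y.
  by rewrite /G big_ord_recl/= diracE memNset// add0e ge0_integral_sum//.
have -> : S N.+1 x = 1 + \int[P x]_y S N y.
  rewrite /S big_ord_recl ge0_integral_sum//; congr (_ + _).
    by rewrite /= patchE ifT ?inE// integral_kernel_cst.
  apply: eq_bigr => i _; rewrite lift0.
  by rewrite [LHS]/= patchE ifT ?inE.
rewrite ge0_muleDr// ?integral_ge0// mule1 addeCA.
rewrite -ge0_integralZl//.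
rewrite -ge0_integralD//; last 2 first.
- by move=> y _; rewrite mule_ge0.
- exact: measurable_funeM.
apply: (@le_trans _ _ (p%:E + \int[P x]_y cst (N%:R * p + B)%:E y)).
  rewrite leeD2l//; apply: ge0_le_integral => //.
  - by move=> y _; rewrite adde_ge0 ?mule_ge0.
  - by apply: emeasurable_funD => //; exact: measurable_funeM.
rewrite integral_kernel_cst -EFinD lee_fin -natr1 mulrDl mul1r addrA.
by rewrite [(p + _)%R]addrC.
Qed.

(** Under [pi] the expected number of visits before [N] equals [N pi(C)], which
    cancels the linear term of [occupation_hitting_le]. *)
Lemma integral_taboo_summable (C : set T) (B : R) : stationary P pi ->
    measurable C -> (0 < fine (pi C))%R -> (0 <= B)%R ->
    (forall N x, C x ->
      \sum_(m < N) iter_kernel P m x C <= (N%:R * fine (pi C) + B)%:E) ->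
  forall N, \sum_(k < N) \int[pi]_x taboo P C (cst 1) k.+1 x <=
    (B / fine (pi C))%:E.
Proof.
move=> Ppi mC; set p := fine (pi C) => p0 B0 occ N.
have cst_ge0 (y : T) : 0 <= cst (1 : \bar R) y by [].
have t0 k x : 0 <= taboo P C (cst 1) k x by exact: taboo_ge0.
have mt k : measurable_fun setT (taboo P C (cst 1) k).
  exact: measurable_taboo.
have mi k := @measurable_iter_kernel _ _ _ P k _ mC.
have i0 := @iter_kernel_ge0 _ T R P.
have pE : pi C = p%:E by rewrite fineK// fin_num_measure.
rewrite EFinM lee_pdivlMr// muleC -(@leeD2lE _ (N%:R * p)%:E)//.
have -> : (N%:R * p)%:E + B%:E = \int[pi]_x cst (N%:R * p + B)%:E x.
  by rewrite integral_cst// [X in _ * X](probability_setT pi) mule1.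
have -> : (N%:R * p)%:E = \sum_(m < N) \int[pi]_x iter_kernel P m x C.
  under eq_bigr do rewrite stationary_iter_kernel// pE.
  by rewrite sumEFin sumr_const card_ord mulr_natl.
rewrite -!ge0_integral_sum//.
rewrite -ge0_integralZl//; last 3 first.
- exact: emeasurable_sum.
- by move=> y _; exact: sume_ge0.
- by rewrite lee_fin ltW.
rewrite -ge0_integralD//; last 4 first.
- by move=> y _; exact: sume_ge0.
- exact: emeasurable_sum.
- by move=> y _; rewrite mule_ge0 ?sume_ge0// lee_fin ltW.
- by apply: measurable_funeM; exact: emeasurable_sum.
apply: ge0_le_integral => //.
- by move=> y _; rewrite adde_ge0 ?mule_ge0 ?sume_ge0// lee_fin ltW.
- apply: emeasurable_funD; first exact: emeasurable_sum.
  by apply: measurable_funeM; exact: emeasurable_sum.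
- by move=> y _; apply: occupation_hitting_le => //; exact: ltW.
Qed.

(** [C] itself is a test set for the total variation distance, and the errors
    form a geometric series. *)
Lemma geometric_occupation_le (C : set T) (rho c : R) :
    measurable C -> (0 <= rho < 1)%R -> (0 <= c)%R ->
    (forall n x, C x ->
      tv_dist (iter_kernel P n x) pi <= (c * rho ^+ n)%:E) ->
  forall N x, C x -> \sum_(m < N) iter_kernel P m x C <=
    (N%:R * fine (pi C) + c / (1 - rho))%:E.
Proof.
move=> mC /andP[rho0 rho1] c0 tvC N x Cx; set p := fine (pi C).
have pE : pi C = p%:E by rewrite fineK// fin_num_measure.
apply: (@le_trans _ _ (\sum_(m < N) (p + c * rho ^+ m)%:E)).
  apply: lee_sum => m _; rewrite EFinD -pE -leeBlDl ?pE//.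
  rewrite (le_trans (lee_abs _))// (le_trans _ (tvC m x Cx))// -pE.
  by apply: ereal_sup_ubound; exists C.
rewrite sumEFin lee_fin big_split/= sumr_const card_ord mulr_natl lerD2l.
rewrite -mulr_sumr ler_wpM2l// -[leRHS]mul1r ler_pdivlMr ?subr_gt0// mulrC.
rewrite -opprB mulNr -subrX1 opprB lerBlDr lerDl exprn_ge0//.
Qed.

(** Avoiding [K] implies avoiding any subset of [K], and some sublevel set of
    [xi] meets [K] in a set of positive measure because [xi] is finite
    [pi]-a.e. *)
Lemma geometric_hitting_summable (K : set T) :
    stationary P pi -> geometrically_ergodic P pi ->
    measurable K -> 0 < pi K ->
  exists S : R, forall N,
    \sum_(k < N) \int[pi]_x taboo P K (cst 1) k.+1 x <= S%:E.
Proof.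
move=> Ppi [rho [xi [rho1 mxi xi1 xi_fin tvxi]]] mK piK0.
have tv0 n x : 0 <= tv_dist (iter_kernel P n x) pi.
  apply: (@le_trans _ _ `|iter_kernel P n x set0 - pi set0|) => //.
  by apply: ereal_sup_ubound; exists set0.
(* A negative [rho] would make the bound at [n = 1] negative. *)
have rho0 : (0 <= rho)%R.
  rewrite leNgt; apply/negP => rho_lt0.
  have := le_trans (tv0 1%N point) (tvxi 1%N point); rewrite expr1.
  rewrite leNgt => /negP; apply; rewrite mule_gt0_lt0// ?lte_fin//.
  by rewrite (lt_le_trans _ (xi1 point)).
pose C n := K `&` [set x | xi x <= n%:R%:E].
have mC n : measurable (C n).
  apply: measurableI => //; rewrite -[X in measurable X]setTI.
  exact: emeasurable_fun_infty_c.
have [n piCn] : exists n, pi (C n) != 0.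
  apply: contrapT => /forallNP piC0.
  have : pi.-negligible K.
    apply: (@negligibleS _ _ _ _ (\bigcup_n C n `|` [set x | ~ (xi x < +oo)])).
      move=> x Kx; have [xi_lt|] := pselect (xi x < +oo); last by right.
      left; have xE : xi x = (fine (xi x))%:E.
        by rewrite fineK// ge0_fin_numE// (le_trans _ (xi1 x)).
      exists (Num.bound (fine (xi x))) => //; split => //=.
      rewrite xE lee_fin ltW// archi_boundP// fine_ge0//.
      by rewrite (le_trans _ (xi1 x)).
    apply: negligibleU => //; apply: negligible_bigcup => n.
    apply/negligibleP => //; apply/eqP/negPn/negP; exact: piC0.
  by move=> /(measure_negligible mK) piK; rewrite piK ltxx in piK0.
have pC0 : (0 < fine (pi (C n)))%R.
  by rewrite fine_gt0// lt0e piCn measure_ge0/= ltey_eq fin_num_measure.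
exists ((n%:R / (1 - rho)) / fine (pi (C n)))%R => N.
have B0 : (0 <= n%:R / (1 - rho))%R by rewrite divr_ge0// subr_ge0 ltW.
apply: (@le_trans _ _ (\sum_(k < N) \int[pi]_x taboo P (C n) (cst 1) k.+1 x)).
  apply: lee_sum => k _; apply: ge0_le_integral => //.
  - by move=> x _; exact: taboo_ge0.
  - exact: measurable_taboo.
  - exact: measurable_taboo.
  - move=> x _; apply: le_taboo => //; first by move=> ? [].
    by move=> y; rewrite lexx andbT.
apply: integral_taboo_summable => //.
apply: geometric_occupation_le; rewrite ?rho0 ?rho1// => m x [Kx xin].
rewrite (le_trans (tvxi m x))// EFinM lee_wpmul2r// lee_fin exprn_ge0//.
Qed.

End hitting.

(** * Sums dominated by a convergent series *)

(** The tail is controlled by [s], and the finitely many other terms by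
    [delta]. *)
Lemma sum_small_of_summable (R : realType) (s : nat -> \bar R) (S : R) :
    (forall k, 0 <= s k)%E -> (forall N, \sum_(k < N) s k <= S%:E)%E ->
  forall e : R, 0 < e -> exists2 delta : R, 0 < delta &
    forall a : nat -> \bar R,
      (forall k, a k <= s k)%E -> (forall k, a k <= delta%:E)%E ->
    forall n, (\sum_(k < n) a k <= e%:E)%E.
Proof.
move=> s0 sS e e0.
have sfin : (\sum_(k <oo) s k < +oo)%E.
  rewrite (@le_lt_trans _ _ S%:E) ?ltry//.
  apply: lime_le; first exact: is_cvg_nneseries.
  by apply: nearW => N; rewrite big_mkord.
have e20 : 0 < e / 2 by rewrite divr_gt0.
have [N _ tailN] : \forall N \near \oo, (\sum_(N <= k <oo) s k <= (e / 2)%:E)%E.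
  have /fine_cvgP[fins /cvgrPdist_le/(_ _ e20)] :=
    nneseries_tail_cvg sfin (fun k _ => s0 k).
  move=> tails; near=> N.
  have finN : (\sum_(N <= k <oo) s k)%E \is a fin_num by near: N.
  rewrite -(fineK finN) lee_fin.
  have : `|0 - fine (\sum_(N <= k <oo) s k)%E| <= e / 2 by near: N.
  by rewrite sub0r normrN; apply: le_trans; exact: ler_norm.
have {tailN} tailN n : (\sum_(N <= k < n) s k <= (e / 2)%:E)%E.
  apply: le_trans (tailN N (leqnn _)).
  exact: nneseries_lim_ge.
exists (e / 2 / N.+1%:R); first by rewrite divr_gt0.
move=> a a_s a_delta n; set delta := e / 2 / N.+1%:R in a_delta.
have head m : (m <= N)%N -> (\sum_(k < m) a k <= (e / 2)%:E)%E.
  move=> mN; apply: (@le_trans _ _ (\sum_(k < m) delta%:E)%E).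
    by apply: lee_sum => k _.
  rewrite sumEFin lee_fin sumr_const card_ord.
  have -> : e / 2 = delta *+ N.+1 by rewrite -[RHS]mulr_natr divfK.
  by rewrite ler_wpMn2l// ?divr_ge0 ?ltW// leqW.
have [nN|Nn] := leqP n N.
  rewrite (le_trans (head n nN))// lee_fin.
  by rewrite ler_pdivrMr// ler_peMr ?ltW// ltr1n.
rewrite -(big_mkord xpredT a) (@big_cat_nat _ _ _ N)//= 1?ltnW//.
rewrite [in leRHS](splitr e) EFinD leeD//; first by rewrite big_mkord head.
by rewrite (le_trans _ (tailN n))// lee_sum.
Unshelve. all: by end_near. Qed.

(** * The filtration of the process *)

Section history.
Context {d d' : measure_display} {R : realType} {T : borelMetricType d R}
  {Omega : measurableType d'} {Pr : probability Omega R}.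
Implicit Types (X : nat -> {RV Pr >-> T}).

Lemma history_preimage X n i A : (i <= n)%N -> measurable A ->
  history X n (X i @^-1` A).
Proof.
move=> le_in mA; apply: sub_sigma_algebra.
have lt_in : (i < n.+1)%N by [].
rewrite (bigD1 (Ordinal lt_in))//=; left.
by exists A => //; rewrite setTI.
Qed.

Lemma history_setI X n E F : history X n E -> history X n F ->
  history X n (E `&` F).
Proof.
exact: (@measurableI _ (g_sigma_algebraType
  (\big[setU/set0]_(i < n.+1)
    preimage_set_system setT (X i : Omega -> T) measurable))).
Qed.

Lemma history_sub X n (M : set (set Omega)) : sigma_algebra setT M ->
  (forall i A, (i <= n)%N -> measurable A -> M (X i @^-1` A)) ->
  history X n `<=` M.
Proof.
move=> sM XM; apply: smallest_sub => //.
apply: (big_ind (fun S => S `<=` M)) => //.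
- by move=> S1 S2 S1M S2M E [/S1M|/S2M].
- by move=> i _ _ [A mA <-]; rewrite setTI; apply: XM => //; rewrite -ltnS.
Qed.

Lemma history_le X m n : (m <= n)%N -> history X m `<=` history X n.
Proof.
move=> mn; apply: history_sub; first exact: smallest_sigma_algebra.
by move=> i A im mA; apply: history_preimage => //; exact: leq_trans mn.
Qed.

Lemma measurable_history X n E : history X n E -> measurable E.
Proof.
move: E; apply: history_sub; first exact: sigma_algebra_measurable.
by move=> i A _ mA; rewrite -[X in measurable X]setTI; exact: measurable_funPT.
Qed.

End history.

(** * The process outside [K] *)

Section chain.
Local Open Scope ereal_scope.
Context {d d' : measure_display} {R : realType} {T : borelMetricType d R}
  {Omega : measurableType d'} {Pr : probability Omega R}.
Variables (P : R.-pker T ~> T) (D : R) (K : set T) (x0 : T)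
  (X : nat -> {RV Pr >-> T}).
Hypotheses (mK : measurable K) (K_x0 : K x0)
  (X_adv : adversarial_chain P D K x0 X).

Let mX n A : measurable A -> measurable (X n @^-1` A).
Proof. exact: measurable_funPTI. Qed.

Let mPX n A : measurable A -> measurable_fun setT (fun w => P (X n w) A).
Proof.
by move=> mA; apply: (measurableT_comp (measurable_kernel P A mA)).
Qed.

(** The Markov property outside [K], for nonnegative functions of the next
    state. *)
Lemma chain_step n (E : set Omega) (g : T -> \bar R) :
    history X n E -> E `<=` X n @^-1` (~` K) ->
    measurable_fun setT g -> (forall x, 0 <= g x) ->
  \int[Pr]_(w in E) \int[P (X n w)]_y g y = \int[Pr]_(w in E) g (X n.+1 w).
Proof.
move=> hE EK mg g0; have mE := measurable_history hE.
apply: (@ge0_integral_conditional _ _ _ _ _ Pr E mE (X n.+1)) => // A mA.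
  exact: mPX.
have [_ /(_ n A mA)[q [_ /integrableP[mq _] qE] qP] _] := X_adv.
apply: (etrans _ (qE _ hE)); apply: ae_eq_integral => //.
- by apply: measurable_funTS; exact: mPX.
- exact: measurable_funTS.
- by apply: filterS qP => w qw Ew; rewrite qw//; exact: EK.
Qed.

Definition avoids (m n : nat) : set Omega :=
  [set w | forall i, (m <= i < n)%N -> ~ K (X i w)].

Lemma measurable_avoids m n : measurable (avoids m n).
Proof.
have -> : avoids m n = \bigcap_i
    (if (m <= i < n)%N then X i @^-1` (~` K) else setT).
  apply/seteqP; split => w /= wK i.
  - by move=> _; case: ifP => // /wK.
  - by move=> mn; have := wK i Logic.I; rewrite mn.
apply: bigcap_measurable => // i _; case: ifP => // _.
by apply: mX; exact: measurableC.
Qed.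

Lemma avoids_recl m n : (m < n)%N ->
  avoids m n = X m @^-1` (~` K) `&` avoids m.+1 n.
Proof.
move=> mn; apply/seteqP; split => w /=.
- move=> wK; split; first by apply: wK; rewrite leqnn.
  by move=> i /andP[mi ni]; apply: wK; rewrite (ltnW mi).
- move=> [wm wK] i /andP[]; rewrite leq_eqVlt => /predU1P[<-//|mi ni].
  by apply: wK; rewrite mi.
Qed.

Lemma avoids_recr m n : (m <= n)%N ->
  avoids m n.+1 = avoids m n `&` X n @^-1` (~` K).
Proof.
move=> mn; apply/seteqP; split => w /=.
- move=> wK; split; last by apply: wK; rewrite mn leqnn.
  by move=> i /andP[mi ni]; apply: wK; rewrite mi ltnW.
- move=> [wK wn] i; rewrite ltnS => /andP[mi]; rewrite leq_eqVlt.
  by move=> /predU1P[->//|ni]; apply: wK; rewrite mi.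
Qed.

Lemma avoids_nn n : avoids n n = setT.
Proof.
by apply/seteqP; split => // w _ i /andP[ni]; rewrite ltnNge ni.
Qed.

(** As long as it stays outside [K], the process follows the law of the
    [P]-chain: at each step the current state can be absorbed into the past
    event [E], which remains in the history. *)
Lemma taboo_law n k (E : set Omega) (g : T -> \bar R) :
    history X n E -> measurable_fun setT g -> (forall x, 0 <= g x) ->
  \int[Pr]_(w in E `&` avoids n (n + k)) g (X (n + k)%N w) =
  \int[Pr]_(w in E) taboo P K g k (X n w).
Proof.
move=> hE mg g0; elim: k n E hE => [|k IHk] n E hE.
  by rewrite addn0 avoids_nn setIT.
have hEK : history X n (E `&` X n @^-1` (~` K)).
  apply: history_setI => //; apply: history_preimage => //.
  exact: measurableC.
rewrite avoids_recl; last by rewrite addnS ltnS leq_addr.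
rewrite setIA -addSnnS.
rewrite IHk; last exact: history_le hEK.
rewrite -chain_step//; last 2 first.
- exact: measurable_taboo.
- by move=> x; exact: taboo_ge0.
rewrite integral_mkcondr; apply: eq_integral => w _ /=.
by rewrite !patchE; congr (if _ then _ else _).
Qed.

(** Almost surely [X_0] is in [K], so a last visit to [K] before time [n+1]
    exists; [j] is its time. *)
Lemma last_visit_decomposition n (B : set Omega) : measurable B ->
  Pr B = \sum_(j < n.+1) Pr (X j @^-1` K `&` avoids j.+1 n.+1 `&` B).
Proof.
elim: n B => [|n IHn] B mB.
  rewrite big_ord1 avoids_nn setIT.
  have [X0 _ _] := X_adv.
  apply/eqP; rewrite eq_le; apply/andP; split; last first.
    by apply: measureIr => //; exact: mX.
  apply: le_measure_ae => //; first by apply: measurableI => //; exact: mX.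
  by apply: filterS X0 => w wx0 Bw; split => //=; rewrite wx0.
have mKB := mX n.+1 mK.
rewrite big_ord_recr/= avoids_nn setIT (measureDI _ mB mKB)/=; congr (_ + _).
  rewrite IHn; last exact: measurableD.
  apply: eq_bigr => j _; rewrite (@avoids_recr _ n.+1)//=.
  congr (Pr _).
  by apply/seteqP; split => w /=; tauto.
by rewrite setIC.
Qed.

End chain.

(** * Enlargements and measurability in a Borel metric space *)

Section geometry.
Context {d : measure_display} {R : realType} {T : borelMetricType d R}.

Lemma measurable_mdist_gt (x : T) (r : R) : measurable [set y | r < mdist x y].
Proof.
rewrite measurable_borel; apply: sub_sigma_algebra; rewrite openE => y /= ry.
apply/nbhs_ballP; exists (mdist x y - r) => /=; first by rewrite subr_gt0.
move=> z; rewrite ballEmdist /= ltrBrDr -ltrBrDl => yz.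
rewrite (lt_le_trans yz)// lerBlDr (metric_sym y z); exact: metric_triangle.
Qed.

Lemma measurable_mdist_le (x : T) (r : R) : measurable [set y | mdist x y <= r].
Proof.
rewrite (_ : [set y | _] = ~` [set y | r < mdist x y]).
  by apply: measurableC; exact: measurable_mdist_gt.
apply/seteqP; split => y /=; first by rewrite leNgt => /negP.
by rewrite leNgt => ?; apply/negP.
Qed.

Lemma measurable_singleton (x : T) : measurable [set x].
Proof.
rewrite (_ : [set x] = [set y | mdist x y <= 0]).
  exact: measurable_mdist_le.
apply/seteqP; split => y /=; first by move=> ->; rewrite mdistxx.
move=> xy; apply/esym/mdist_positivity/eqP.
by rewrite eq_le xy mdist_ge0.
Qed.

Lemma enlargementD (K : set T) (r s : R) (x y : T) :
  enlargement K r x -> mdist x y <= s -> enlargement K (s + r) y.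
Proof.
rewrite /enlargement/= => Kx xy.
rewrite (le_trans (edist_inf_triangle K y x))//.
by rewrite EFinD leeD// edist_mdist lee_fin metric_sym.
Qed.

Lemma enlargement_bounded (K : set T) (r : R) (o x0 : T) :
  metric_bounded K -> K x0 -> exists L : R, forall y,
  enlargement K r y -> mdist o y <= L.
Proof.
(* The distance to [K] need not be attained, hence [r + 1]. *)
move=> [b Kb] Kx0; exists (mdist o x0 + (b + (r + 1))) => y Ky.
have : (edist_inf K y < (r + 1)%:E)%E.
  by rewrite (le_lt_trans Ky)// lte_fin ltrDl.
move=> /ereal_inf_lt[_ [a Ka <-]]; rewrite edist_mdist lte_fin => ya.
rewrite (le_trans (metric_triangle o x0 y))// lerD2l.
rewrite (le_trans (metric_triangle x0 a y))// lerD ?Kb//.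
by rewrite metric_sym ltW.
Qed.

End geometry.

(** * Excursions away from [K] *)

Section exits.
Local Open Scope ereal_scope.
Context {d d' : measure_display} {R : realType} {T : borelMetricType d R}
  {Omega : measurableType d'} {Pr : probability Omega R}.
Variables (P : R.-pker T ~> T) (pi : probability T R) (D : R) (K : set T)
  (x0 : T) (X : nat -> {RV Pr >-> T}).

(** From [K_D] one step stays in [K_{2D}], so the domination on subsets of
    [K_{2D}] extends to all sets; its constant can be taken nonnegative. *)
Lemma kernel_le_stationary :
    (forall x, P x [set y | (mdist x y <= D)%R] = 1) ->
    (exists M : R, forall x A, enlargement K D x -> measurable A ->
       A `<=` enlargement K (2 * D) -> P x A <= M%:E * pi A) ->
  exists2 M : R, (0 <= M)%R & forall x A, enlargement K D x -> measurable A ->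
    P x A <= M%:E * pi A.
Proof.
move=> jump [M PM]; exists (Num.max M 0%R); first by rewrite le_max lexx orbT.
move=> x A Kx mA; pose B := [set y | (mdist x y <= D)%R].
have mB : measurable B by exact: measurable_mdist_le.
have PAB : P x A = P x (A `&` B).
  rewrite (measureDI _ mA mB)/= [X in X + _](_ : _ = 0) ?add0e//.
  apply/eqP; rewrite eq_le measure_ge0 andbT.
  rewrite (@le_trans _ _ (P x (~` B)))//; last first.
    rewrite -(@leeD2rE _ 1)// add0e -[X in _ + X](jump x) -setTD.
    rewrite -[X in _ + P x X](setTI B) -(measureDI _ measurableT mB).
    by rewrite [leLHS](prob_kernel (s := P)).
  by rewrite le_measure// ?inE//; [exact: measurableD|exact: measurableC].
rewrite PAB (le_trans (PM x _ Kx (measurableI _ _ mA mB) _))//.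
  move=> y [_ xy]; rewrite mulr_natl mulr2n; exact: enlargementD xy.
apply: (@le_trans _ _ ((Num.max M 0)%:E * pi (A `&` B))).
  by rewrite lee_wpmul2r// lee_fin le_max lexx.
by rewrite lee_wpmul2l ?lee_fin ?le_max ?lexx ?orbT// measureIl.
Qed.

Hypotheses (mK : measurable K) (K_x0 : K x0)
  (X_adv : adversarial_chain P D K x0 X).
Variable M : R.
Hypotheses (M0 : (0 <= M)%R) (PM : forall x A, enlargement K D x ->
  measurable A -> P x A <= M%:E * pi A).

Let mX n A : measurable A -> measurable (X n @^-1` A).
Proof. exact: measurable_funPTI. Qed.

Lemma integral_kernel_le_stationary x (g : T -> \bar R) : enlargement K D x ->
    measurable_fun setT g -> (forall y, 0 <= g y) ->
  \int[P x]_y g y <= M%:E * \int[pi]_y g y.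
Proof.
move=> Kx mg g0; rewrite -(ge0_integral_mscale _ _ (NngNum M0))//.
apply: ge0_le_measure_integral => // A mA.
exact: PM.
Qed.

(** The process leaves [K] into [K_D], where one step of [P] is dominated by
    [M pi]; the rest of the excursion is then governed by the killed chain
    started from [pi].  The last factor is the probability of the exit at time
    [j]. *)
Lemma last_exit_le j k (A : set T) : measurable A ->
  Pr (X j @^-1` K `&` avoids K X j.+1 (j.+1 + k.+1) `&`
      X (j.+1 + k.+1)%N @^-1` A) <=
  M%:E * \int[pi]_y taboo P K (EFin \o \1_A) k y *
  Pr (X j @^-1` K `&` X j.+1 @^-1` (~` K)).
Proof.
move=> mA; set g : T -> \bar R := EFin \o \1_A.
have mg : measurable_fun setT g.
  by apply/measurable_EFinP; exact: measurable_indic.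
have g0 y : 0 <= g y by rewrite lee_fin.
have mKj := mX j mK; have mnK := mX j.+1 (measurableC mK).
have hK : history X j.+1 (X j @^-1` K) by exact: history_preimage.
have mt : measurable_fun setT (taboo P K g k) by exact: measurable_taboo.
have t0 y : 0 <= taboo P K g k y by exact: taboo_ge0.
have mPt : measurable_fun setT (fun w => \int[P (X j.+1 w)]_y taboo P K g k y).
  by apply: measurableT_comp (measurable_integral_kernel _ mt t0) _.
have -> : Pr (X j @^-1` K `&` avoids K X j.+1 (j.+1 + k.+1) `&`
    X (j.+1 + k.+1)%N @^-1` A) =
    \int[Pr]_(w in X j @^-1` K `&` X j.+1 @^-1` (~` K))
      \int[P (X j.+1 w)]_y taboo P K g k y.
  transitivity (\int[Pr]_(w in X j @^-1` K) taboo P K g k.+1 (X j.+1 w)).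
    rewrite -(taboo_law mK X_adv)//.
    rewrite (eq_integral (EFin \o \1_(X (j.+1 + k.+1)%N @^-1` A)))//.
    rewrite integral_indic//; first by rewrite setIC.
    - by apply: measurableI => //; exact: measurable_avoids.
    - exact: mX.
  rewrite integral_mkcondr; apply: eq_integral => w _ /=.
  by rewrite !patchE; congr (if _ then _ else _).
rewrite -integral_cst; last exact: measurableI.
apply: ae_ge0_le_integral => //.
- exact: measurableI.
- by move=> w _; exact: integral_ge0.
- exact: measurable_funTS.
- by move=> w _; rewrite mule_ge0 ?lee_fin ?integral_ge0.
- have [_ _ /(_ j)] := X_adv; apply: filterS => w KD [Kw _].
  by apply: integral_kernel_le_stationary => //; exact: KD.
Qed.

End exits.

(** * Uniform smallness of small far sets *)

Section tightness.
Local Open Scope ereal_scope.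
Context {d d' : measure_display} {R : realType} {T : borelMetricType d R}
  {Omega : measurableType d'} {Pr : probability Omega R}.
Variables (P : R.-pker T ~> T) (pi : probability T R) (D : R) (K : set T)
  (x0 : T) (X : nat -> {RV Pr >-> T}) (M : R).
Hypotheses (mK : measurable K) (K_x0 : K x0)
  (X_adv : adversarial_chain P D K x0 X)
  (M0 : (0 <= M)%R)
  (PM : forall x A, enlargement K D x -> measurable A -> P x A <= M%:E * pi A)
  (P_stationary : stationary P pi).

Let mX n A : measurable A -> measurable (X n @^-1` A).
Proof. exact: measurable_funPTI. Qed.

Let r (A : set T) k := \int[pi]_y taboo P K (EFin \o \1_A) k y.

Let mind (A : set T) : measurable A ->
  measurable_fun setT (EFin \o \1_A : T -> \bar R).
Proof. by move=> mA; apply/measurable_EFinP; exact: measurable_indic. Qed.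

Let ind0 (A : set T) (y : T) : 0 <= (EFin \o \1_A : T -> \bar R) y.
Proof. by rewrite lee_fin. Qed.

Let r_ge0 A k : 0 <= r A k.
Proof. by apply: integral_ge0 => y _; exact: taboo_ge0. Qed.

Let r_le A k : measurable A -> r A k <= pi A.
Proof.
move=> mA.
apply: le_trans (integral_taboo_le k P_stationary mK (mind mA) (ind0 A)) _.
by rewrite integral_indic// setIT.
Qed.

Let exit j := Pr (X j @^-1` K `&` X j.+1 @^-1` (~` K)).

(** Almost surely the last visit is not at time [n], since [X_{n+1}] would then
    be in [K_D]. *)
Lemma last_exit_sum_le n A : measurable A -> A `<=` ~` enlargement K D ->
  Pr (X n.+1 @^-1` A) <= \sum_(j < n) M%:E * r A (n - j.+1) * exit j.
Proof.
move=> mA AKD; rewrite (last_visit_decomposition mK K_x0 X_adv n); last first.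
  exact: mX.
rewrite big_ord_recr/=.
rewrite [X in _ + X](_ : _ = 0) ?adde0.
  apply: lee_sum => j _.
  have nE : n.+1 = (j.+1 + (n - j.+1).+1)%N by rewrite addnS subnKC.
  rewrite [in leLHS]nE; exact: (last_exit_le mK X_adv M0 PM j (n - j.+1) mA).
apply/eqP; rewrite eq_le measure_ge0 andbT -(measure0 Pr) avoids_nn setIT.
apply: le_measure_ae => //; first by apply: measurableI; exact: mX.
have [_ _ /(_ n)] := X_adv; apply: filterS => w KD [Kw Aw].
by have := AKD _ Aw (KD Kw).
Qed.

(** [last_exit_le] applied to [A = K] shows that each later return to [K] has
    probability [0]. *)
Lemma null_no_return j k : pi K = 0 ->
  Pr (X j @^-1` K `&` avoids K X j.+1 (j.+1 + k.+1)) = exit j.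
Proof.
move=> piK0; elim: k => [|k IHk].
  by rewrite addn1 avoids_recl// avoids_nn setIT.
rewrite -{}IHk addnS avoids_recr ?leq_addr//.
set E := X j @^-1` K `&` avoids _ _ _ _.
have mB := mX (j.+1 + k.+1) mK.
have mE : measurable E.
  by apply: measurableI; [exact: mX|exact: measurable_avoids].
rewrite setIA -/E [RHS](measureDI _ mE mB)/=.
rewrite [X in _ = _ + X](_ : _ = 0) ?adde0 ?setDE//.
apply/eqP; rewrite eq_le measure_ge0 andbT.
apply: (le_trans (last_exit_le mK X_adv M0 PM j k mK)).
rewrite (_ : \int[pi]_y _ = 0) ?mule0 ?mul0e//; apply/eqP.
by rewrite eq_le r_ge0 -piK0 r_le.
Qed.

(** Each exit is almost surely the last one, so the exit probabilities in
    [last_exit_sum_le] sum to at most [1]. *)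
Lemma null_adversarial_le n A : pi K = 0 -> measurable A ->
    A `<=` ~` enlargement K D ->
  Pr (X n.+1 @^-1` A) <= M%:E * pi A.
Proof.
move=> piK0 mA AKD; apply: (le_trans (last_exit_sum_le n mA AKD)).
have MA0 : 0 <= M%:E * pi A by rewrite mule_ge0.
apply: (@le_trans _ _ (\sum_(j < n) M%:E * pi A *
    Pr (X j @^-1` K `&` avoids K X j.+1 n.+1 `&` setT))).
  apply: lee_sum => j _; rewrite setIT.
  have nE : n.+1 = (j.+1 + (n - j.+1).+1)%N by rewrite addnS subnKC.
  rewrite [X in _ <= _ * Pr (_ `&` avoids _ _ _ X)]nE null_no_return//.
  by rewrite lee_wpmul2r// lee_wpmul2l// r_le.
rewrite -ge0_sume_distrr//.
rewrite -[leRHS]mule1 lee_wpmul2l// -(probability_setT Pr).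
rewrite [leRHS](last_visit_decomposition mK K_x0 X_adv n)//.
by rewrite big_ord_recr/= leeDl.
Qed.

(** If [pi K > 0], the terms of [last_exit_sum_le] are at most [M * pi A] and
    are dominated by a convergent series that depends neither on [A] nor on
    [n]. *)
Lemma adversarial_small (e : R) : geometrically_ergodic P pi -> (0 < e)%R ->
  exists2 delta : R, (0 < delta)%R & forall A, measurable A ->
    A `<=` ~` enlargement K D -> pi A <= delta%:E ->
  forall n, Pr (X n.+1 @^-1` A) <= e%:E.
Proof.
move=> geoP e0; have M1 : (0 < M + 1)%R by rewrite ltr_wpDl.
(* [M] may be [0], hence the division by [M + 1]. *)
have scaleM (a : R) (b : \bar R) : (0 < a)%R ->
    b <= (a / (M + 1))%:E -> M%:E * b <= a%:E.
  move=> a0 ba; apply: (@le_trans _ _ (M%:E * (a / (M + 1))%:E)).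
    by rewrite lee_wpmul2l.
  rewrite -EFinM lee_fin mulrCA ler_piMr// ?(ltW a0)//.
  by rewrite ler_pdivrMr// mul1r lerDl.
have [piK0|piK0] := eqVneq (pi K) 0.
  exists (e / (M + 1))%R; first by rewrite divr_gt0.
  move=> A mA AKD Ae n; apply: (le_trans (null_adversarial_le n piK0 mA AKD)).
  exact: scaleM.
have piK_gt0 : 0 < pi K by rewrite lt0e piK0/=.
have [S hitS] := geometric_hitting_summable P_stationary geoP mK piK_gt0.
pose s k := M%:E * \int[pi]_x taboo P K (cst 1) k x.
have s0 k : 0 <= s k.
  by rewrite mule_ge0// integral_ge0// => x _; exact: taboo_ge0.
have sS N : \sum_(k < N) s k <= (M * (1 + S))%:E.
  rewrite -ge0_sume_distrr//; last first.
    by move=> k _; apply: integral_ge0 => x _; exact: taboo_ge0.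
  rewrite EFinM lee_wpmul2l// EFinD.
  have S0 : 0 <= S%:E by have := hitS 0%N; rewrite big_ord0.
  case: N => [|N]; first by rewrite big_ord0 adde_ge0.
  rewrite big_ord_recl leeD//.
  by rewrite /= integral_cst// [X in _ * X](probability_setT pi) mule1.
have [delta0 delta0_gt0 small] := sum_small_of_summable s0 sS e0.
exists (delta0 / (M + 1))%R; first by rewrite divr_gt0.
move=> A mA AKD Adelta n; apply: (le_trans (last_exit_sum_le n mA AKD)).
apply: (@le_trans _ _ (\sum_(k < n) M%:E * r A k)).
  rewrite [leRHS](reindex_inj rev_ord_inj)/=; apply: lee_sum => j _.
  rewrite -[leRHS]mule1 lee_wpmul2l ?mule_ge0//.
  apply: probability_le1; apply: measurableI; apply: mX => //.
  exact: measurableC.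
apply: (small (fun k => M%:E * r A k)) => k.
- rewrite lee_wpmul2l//; apply: ge0_le_integral => //.
  + by move=> y _; exact: taboo_ge0.
  + by apply: measurable_taboo => //; exact: mind.
  + exact: measurable_taboo.
  + move=> y _; apply: le_taboo => //; first exact: mind.
    move=> z.
    by rewrite ind0 lee_fin indicE lern1 leq_b1.
- by apply: scaleM => //; apply: le_trans Adelta; exact: r_le.
Qed.

End tightness.

(** * Boundedness in probability *)

Lemma near_ereal_sup_cvg0 (R : realType) (f : R -> nat -> \bar R) :
    (forall L n, (0 <= f L n)%E) ->
    (forall e : R, 0 < e -> exists L0 : R, forall L n,
      L0 <= L -> (f L n <= e%:E)%E) ->
  ereal_sup [set f L n | n in [set: nat]] @[L --> +oo] --> 0%E.
Proof.
move=> f0 fe.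
have sup0 L : (0 <= ereal_sup [set f L n | n in [set: nat]])%E.
  by apply: le_trans (f0 L 0%N) _; apply: ereal_sup_ubound; exists 0%N.
have supe (e : R) : 0 < e ->
    \forall L \near +oo%R, (ereal_sup [set f L n | n in [set: nat]] <= e%:E)%E.
  move=> /fe[L0 fL0]; near=> L.
  apply: ge_ereal_sup => _ [n _ <-]; apply: fL0.
  by near: L; apply: nbhs_pinfty_ge; rewrite num_real.
apply/fine_cvgP; split.
  apply: filterS (supe 1 ltr01) => L Le1.
  by rewrite ge0_fin_numE// (le_lt_trans Le1)// ltry.
apply/cvgrPdist_le => e e0; apply: filterS (supe e e0) => L Le.
rewrite sub0r normrN ger0_norm ?fine_ge0//= -lee_fin fineK//.
by rewrite ge0_fin_numE// (le_lt_trans Le)// ltry.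
Unshelve. all: by end_near. Qed.

Lemma far_measure_small {d} {R : realType} {T : borelMetricType d R}
    (pi : probability T R) (o : T) (e : R) : 0 < e ->
  exists N : nat, (pi [set y | (N%:R < mdist o y)%R] <= e%:E)%E.
Proof.
move=> e0; pose F (n : nat) := [set y : T | n%:R < mdist o y].
have mF n : measurable (F n) by exact: measurable_mdist_gt.
have capF : \bigcap_n F n = set0.
  apply/seteqP; split => // y /(_ (Num.bound (mdist o y)) Logic.I).
  by rewrite /F/= ltNge ltW// archi_boundP// mdist_ge0.
have : (pi \o F) n @[n --> \oo] --> pi (\bigcap_n F n).
  apply: nonincreasing_cvg_mu => //.
  - by rewrite ltey_eq fin_num_measure.
  - exact: bigcapT_measurable.
  - move=> m n mn; apply/subsetPset => y /=; apply: le_lt_trans.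
    by rewrite ler_nat.
rewrite capF measure0.
move=> /fine_cvgP[_ /cvgrPdist_le/(_ _ e0)[N _ /(_ N (leqnn N))]].
rewrite /= sub0r normrN ger0_norm ?fine_ge0// => piN; exists N.
by rewrite -(fineK (fin_num_measure pi _ (mF N))) lee_fin.
Qed.

Theorem theorem7 (R : realType) (d d' : measure_display)
    (T : borelMetricType d R) (o : T)
    (P : R.-pker T ~> T) (pi : probability T R) (D : R)
    (K : set T) (x0 : T)
    (Omega : measurableType d') (Pr : probability Omega R)
    (X : nat -> {RV Pr >-> T})
    (P_harris : harris_ergodic P pi)
    (P_jump : forall x, P x [set y | mdist x y <= D] = 1%E)
    (K_meas : measurable K) (K_bounded : metric_bounded K) (K_x0 : K x0)
    (X_adversarial : adversarial_chain P D K x0 X)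
    (A4 : geometrically_ergodic P pi)
    (A5 : exists M : R, forall x (A : set T),
        enlargement K D x -> measurable A -> A `<=` enlargement K (2 * D) ->
        (P x A <= M%:E * pi A)%E) :
  bounded_in_probability o x0 X.
Proof.
have [P_stationary _] := P_harris.
have [M M0 PM] := kernel_le_stationary P_jump A5.
have [X0 _ _] := X_adversarial.
have mX n A : measurable A -> measurable (X n @^-1` A).
  exact: measurable_funPTI.
have cond_le A : measurable A ->
    (cond_prob Pr A [set w | X 0%N w = x0])%:E = Pr A.
  move=> mA; rewrite /cond_prob; set E := [set w | _].
  have mE : measurable E by exact: (mX 0%N _ (measurable_singleton x0)).
  have PrE B : measurable B -> Pr (B `&` E) = Pr B.
    move=> mB; apply/eqP; rewrite eq_le measureIl//=.
    apply: le_measure_ae => //; first exact: measurableI.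
    by apply: filterS X0.
  rewrite PrE// -(setTI E) PrE// probability_setT divr1 fineK//.
  exact: fin_num_measure.
have mfar L : measurable [set y | L < mdist y o].
  rewrite (_ : [set y | _] = [set y | L < mdist o y]).
    exact: measurable_mdist_gt.
  by apply/seteqP; split => y /=; rewrite metric_sym.
have [L1 KD_L1] := enlargement_bounded D o K_bounded K_x0.
apply: near_ereal_sup_cvg0 => [L n|e e0].
  by rewrite cond_le//; exact: (mX n _ (mfar L)).
have [delta delta0 small] :=
  adversarial_small K_meas K_x0 X_adversarial M0 PM P_stationary A4 e0.
have [N piN] := far_measure_small pi o delta0.
exists (Num.max (mdist x0 o) (Num.max L1 N%:R)) => L n.
rewrite !ge_max => /and3P[x0L L1L NL].
rewrite cond_le//; last exact: (mX n _ (mfar L)).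
case: n => [|n].
  apply: (@le_trans _ _ (Pr set0)); last by rewrite measure0 lee_fin ltW.
  apply: le_measure_ae => //; first exact: (mX 0%N _ (mfar L)).
  by apply: filterS X0 => w /= ->; rewrite ltNge x0L.
apply: (small _ (mfar L)).
- move=> y /= Ly /KD_L1; rewrite leNgt => /negP; apply.
  by rewrite metric_sym (le_lt_trans L1L).
- apply: le_trans piN; apply: le_measure; rewrite ?inE//.
    exact: measurable_mdist_gt.
  by move=> y /=; rewrite metric_sym; apply: le_lt_trans.
Qed.
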